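(* There is a constant $c>0$ such that for all $n\ge1$ and all $\varepsilon\in(0,1)$, $E(n,\varepsilon)\le 2^{cn\log n}\cdot(1+\log 1/\varepsilon)^n$.
   Context: Let $H=[-1,1]^n$ and $H_\varepsilon=[-1+\varepsilon,1-\varepsilon]^n$. An ellipsoid is the image of the Euclidean unit ball under an affine map $x\mapsto Ex+d$ with $E$ non-singular. $E(n,\varepsilon)$ denotes the smallest number of ellipsoids, each contained in $H$, whose union covers $H_\varepsilon$. Logarithms are base 2. *)

(* Defs.v *)
From HB Require Import structures.
From mathcomp Require Import all_boot all_order all_algebra.
From mathcomp Require Import all_classical all_reals all_analysis.
Set Implicit Arguments.
Unset Strict Implicit.
Unset Printing Implicit Defensive.
Import Order.TTheory GRing.Theory Num.Theory.

Local Open Scope classical_set_scope.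
Local Open Scope ring_scope.

Definition log2 (R : realType) (x : R) : R := ln x / ln 2.

(* The library norm on matrices is the sup norm, hence this definition. *)
Definition euclidean_norm (R : realType) (n : nat) (x : 'cV[R]_n) : R :=
  Num.sqrt (\sum_(i < n) x i ord0 ^+ 2).

Definition unit_ball (R : realType) (n : nat) : set 'cV[R]_n :=
  [set x | euclidean_norm x <= 1].

Definition is_ellipsoid (R : realType) (n : nat) (A : set 'cV[R]_n) : Prop :=
  exists (E : 'M[R]_n) (d : 'cV[R]_n),
    E \in unitmx /\ A = [set E *m x + d | x in @unit_ball R n].

Definition hypercube (R : realType) (n : nat) : set 'cV[R]_n :=
  [set x | forall i : 'I_n, -1 <= x i ord0 <= 1].

Definition inner_hypercube (R : realType) (n : nat) (eps : R) : set 'cV[R]_n :=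
  [set x | forall i : 'I_n, -1 + eps <= x i ord0 <= 1 - eps].

Definition ellipsoid_coverable (R : realType) (n : nat) (eps : R) (N : nat) :
    Prop :=
  exists A : 'I_N -> set 'cV[R]_n,
    (forall k, is_ellipsoid (A k) /\ A k `<=` @hypercube R n) /\
    @inner_hypercube R n eps `<=` \bigcup_(k in [set: 'I_N]) A k.

(* Valued in \bar R so that the absence of a finite cover gives +oo;
   otherwise the infimum is the minimum, as the set consists of naturals. *)
Definition ellipsoid_number (R : realType) (n : nat) (eps : R) : \bar R :=
  ereal_inf [set (N%:R)%:E | N in ellipsoid_coverable n eps].

(* Main.v *)
Require Import Defs.
From HB Require Import structures.
From mathcomp Require Import all_boot all_order all_algebra.
From mathcomp Require Import all_classical all_reals all_analysis.
From mathcomp Require Import lra.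
Import Order.TTheory GRing.Theory Num.Theory.
Local Open Scope classical_set_scope.
Local Open Scope ring_scope.

(** Axis-parallel ellipsoids suffice. In one coordinate put [q = 1 - 1/n] and
    use the centres [1 - q ^ k] and [q ^ k - 1] with semi-axis [q ^ k], which is
    the distance from the centre to the boundary. A box whose half-widths are
    [1/n] times the semi-axes of an ellipsoid lies in that ellipsoid, and the
    intervals of half-width [q ^ k / n] around these centres cover
    [[-1 + eps, 1 - eps]] as soon as [q ^ K <= eps], for which
    [K <= n (1 + log2 (1 / eps))] indices are enough. Taking all combinations
    over the coordinates gives [(2 K) ^ n] ellipsoids, and [2 n <= n ^ 2]
    unless [n = 1], where [H] is itself an ellipsoid. *)

Lemma unit_ball_coord (R : realType) (n : nat) (y : 'cV[R]_n) (i : 'I_n) :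
  unit_ball y -> `|y i ord0| <= 1.
Proof.
rewrite /unit_ball /= /euclidean_norm => yB.
apply: le_trans yB; rewrite -sqrtr_sqr; apply: ler_wsqrtr.
rewrite (bigD1 i) //= lerDl.
by apply: sumr_ge0 => j _; exact: sqr_ge0.
Qed.

(** The [n] squares are at most [n^-2] each, so they sum to at most [1/n]. *)
Lemma unit_ball_small_coords (R : realType) (n : nat) (y : 'cV[R]_n) :
  (forall i, `|y i ord0| <= n%:R^-1) -> unit_ball y.
Proof.
move=> yn; rewrite /unit_ball /= /euclidean_norm -sqrtr1; apply: ler_wsqrtr.
apply: (@le_trans _ _ (\sum_(i < n) (n%:R^-1 : R) ^+ 2)).
  by apply: ler_sum => i _; rewrite -real_normK ?num_real// lerXn2r ?nnegrE.
rewrite sumr_const card_ord -[_ ^+ 2 *+ n]mulr_natl.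
have [->|n_gt0] := posnP n; first by rewrite mul0r.
have n_neq0 : n%:R != 0 :> R by rewrite pnatr_eq0 -lt0n.
by rewrite expr2 mulrA divff// mul1r invf_le1 ?ltr0n// ler1n.
Qed.

(** Reduction to one dimension: a map from coordinates to [T] picks a centre and a semi-axis in each
    coordinate. The bound on [|m t| + a t] keeps the bounding box of the ellipsoid in the cube, and
    the factor [1/n] yields a box inside the ellipsoid. *)
Lemma coverable_of_interval_cover (R : realType) (n : nat) (eps : R)
    (T : finType) (m a : T -> R) :
  (forall t, 0 < a t) -> (forall t, `|m t| + a t <= 1) ->
  (forall x, -1 + eps <= x <= 1 - eps -> exists t, `|x - m t| <= a t / n%:R) ->
  ellipsoid_coverable n eps (#|T| ^ n)%N.
Proof.
move=> a_gt0 ma_le1 cover.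
have -> : (#|T| ^ n)%N = #|{ffun 'I_n -> T}| by rewrite card_ffun card_ord.
pose E (f : {ffun 'I_n -> T}) : 'M[R]_n := diag_mx (\row_i a (f i)).
pose d (f : {ffun 'I_n -> T}) : 'cV[R]_n := \col_i m (f i).
have EE f y i : (E f *m y + d f) i ord0 = a (f i) * y i ord0 + m (f i).
  by rewrite !mxE (bigD1 i) //= big1 ?addr0 ?mxE ?eqxx// => j ji;
     rewrite !mxE eq_sym (negPf ji) mul0r.
exists (fun k => [set E (enum_val k) *m y + d (enum_val k) | y in @unit_ball R n]).
split.
  move=> k; split.
    exists (E (enum_val k)), (d (enum_val k)); split=> //.
    rewrite unitmxE det_diag unitfE; apply/prodf_neq0 => i _.
    by rewrite mxE gt_eqF.
  move=> _ [y yB <-] i; rewrite EE -ler_norml.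
  apply: le_trans (ma_le1 (enum_val k i)); rewrite addrC.
  apply: le_trans (ler_normD _ _) _; rewrite lerD2l normrM gtr0_norm//.
  by rewrite ler_piMr ?(ltW (a_gt0 _))//; exact: unit_ball_coord.
move=> x xH.
have /choice [f fP] : forall i, exists t, `|x i ord0 - m t| <= a t / n%:R.
  by move=> i; exact: cover (xH i).
exists (enum_rank (finfun f)) => //=; rewrite enum_rankK.
exists (\col_i ((x i ord0 - m (f i)) / a (f i))).
  apply: unit_ball_small_coords => i; rewrite mxE normrM normfV (gtr0_norm (a_gt0 _)).
  by rewrite ler_pdivrMr// mulrC.
apply/colP => i; rewrite EE mxE !ffunE.
by rewrite mulrC divfK ?gt_eqF// subrK.
Qed.

(** Lower the exponent from [K] until a power reaches [u]; this happens at [q ^+ 0 = 1] at the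
    latest. *)
Lemma geometric_bracket (R : realType) (q u : R) (K : nat) :
  u <= 1 -> q ^+ K <= u -> (0 < K)%N ->
  exists k : 'I_K, q ^+ k.+1 <= u <= q ^+ k.
Proof.
move=> u_le1; elim: K => // K IH qu _.
have [uq|qu'] := leP u (q ^+ K); first by exists ord_max; rewrite /= qu uq.
case: K => [|K] in IH qu qu' *.
  by move: (lt_le_trans qu' u_le1); rewrite expr0 ltxx.
have [//|k kP] := IH (ltW qu').
by exists (widen_ord (leqnSn _) k).
Qed.

Lemma geometric_cover (R : realType) (n : nat) (eps : R) (K : nat) :
  (2 <= n)%N -> 0 < eps -> (0 < K)%N -> (1 - n%:R^-1) ^+ K <= eps ->
  ellipsoid_coverable n eps ((2 * K) ^ n)%N.
Proof.
move=> n_ge2 eps_gt0 K_gt0; set q : R := 1 - n%:R^-1 => qK.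
have n_gt1 : 1 < n%:R :> R by rewrite ltr1n.
have q_gt0 : 0 < q by rewrite subr_gt0 invf_lt1// (lt_trans ltr01).
have q_le1 : q <= 1 by rewrite gerBl invr_ge0.
have -> : (2 * K)%N = #|{: bool * 'I_K}| by rewrite card_prod card_bool card_ord.
have qk_le1 k : q ^+ k <= 1 by rewrite exprn_ile1 // ltW.
apply: (@coverable_of_interval_cover R n eps (bool * 'I_K)%type
  (fun t => (-1) ^+ t.1 * (1 - q ^+ t.2)) (fun t => q ^+ t.2)).
- by move=> t; rewrite exprn_gt0.
- by move=> t; rewrite normrM normr_sign mul1r ger0_norm ?subr_ge0// subrK.
move=> x; have -> : -1 + eps = - (1 - eps) by rewrite opprB addrC.
rewrite -ler_norml => xeps.
(* The distance [1 - |x|] to the boundary is at least [eps], hence at least [q ^+ K]. *)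
have [k /andP[uk ku]] : exists k : 'I_K, q ^+ k.+1 <= 1 - `|x| <= q ^+ k.
  by apply: geometric_bracket; rewrite // ?gerBl//; lra.
exists (x < 0, k) => /=.
rewrite {1}[x]realEsign ?num_real// -mulrBr normrM normr_sign mul1r.
(* By the choice of [q], going outward from the centre [1 - q ^+ k] by [q ^+ k / n] leads exactly to
   the next centre [1 - q ^+ k.+1], so [|x|] lies between the two. *)
have qS : q ^+ k.+1 = q ^+ k - q ^+ k / n%:R by rewrite exprSr /q mulrBr mulr1.
have h0 : 0 <= q ^+ k / n%:R by rewrite divr_ge0 // exprn_ge0 // ltW.
rewrite ler_norml; lra.
Qed.

(** From [1 - 1/n <= exp (- 1/n)], any [K >= n * ln (1 / eps)] works. Rounding up costs at most
    [1 <= n], and [ln <= log2] on [[1, +oo)] because [ln 2 <= 1]. *)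
Lemma geometric_index (R : realType) (n : nat) (eps : R) :
  (1 <= n)%N -> 0 < eps -> eps < 1 ->
  exists K : nat, [/\ (0 < K)%N, (1 - n%:R^-1) ^+ K <= eps &
    K%:R <= n%:R * (1 + log2 (1 / eps))].
Proof.
move=> n_ge1 eps_gt0 eps_lt1.
have n_ge1R : 1 <= n%:R :> R by rewrite ler1n.
have n_gt0 : 0 < n%:R :> R by rewrite ltr0n.
set l := ln (1 / eps).
have l_ge0 : 0 <= l by rewrite ln_ge0// ler_pdivlMr// mul1r ltW.
have ln2_gt0 : 0 < ln 2 :> R by rewrite ln_gt0// ltr1n.
have ln2_le1 : ln 2 <= 1 :> R by have := @le_ln1Dx R 1 ltac:(lra).
have nl_ge0 : 0 <= n%:R * l by rewrite mulr_ge0// ltW.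
exists (Num.truncn (n%:R * l)).+1; split=> //.
  have expB : 1 - n%:R^-1 <= expR (- n%:R^-1) :> R by exact: expR_ge1Dx.
  apply: (@le_trans _ _ (expR (- n%:R^-1) ^+ (Num.truncn (n%:R * l)).+1)).
    by rewrite lerXn2r ?nnegrE ?expR_ge0 ?subr_ge0 ?invf_le1.
  rewrite -expRM_natl -[leRHS]lnK ?posrE// ler_expR.
  have -> : ln eps = - l by rewrite /l div1r lnV ?posrE// opprK.
  rewrite -mulr_natl mulrN lerN2 ler_pdivlMr// mulrC mulr1 ltW//.
  exact: truncnS_gt.
rewrite -natr1 mulrDr mulr1 addrC lerD//.
apply: le_trans (_ : n%:R * l <= _); first by rewrite truncn_le.
by rewrite ler_pM2l// /log2 -/l ler_pdivlMr// ler_piMr.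
Qed.

Theorem theorem2p3 (R : realType) :
  exists c : R, 0 < c /\
    forall (n : nat) (eps : R), (1 <= n)%N -> 0 < eps -> eps < 1 ->
      (ellipsoid_number n eps <=
        (2 `^ (c * n%:R * log2 n%:R) * (1 + log2 (1 / eps)) ^+ n)%:E)%E.
Proof.
(* With [c = 2] the first factor is [(n ^ 2) ^ n]: one [n] comes from the bound on [K], the other
   absorbs the two signs. *)
exists 2; split=> // n eps n_ge1 eps_gt0 eps_lt1.
suff [N covN leN] : exists2 N, ellipsoid_coverable n eps N &
    N%:R <= 2 `^ (2 * n%:R * log2 n%:R) * (1 + log2 (1 / eps)) ^+ n.
  apply: (@le_trans _ _ N%:R%:E); last by rewrite lee_fin.
  by apply: ereal_inf_lbound; exists N.
have ln2_gt0 : 0 < ln 2 :> R by rewrite ln_gt0// ltr1n.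
have -> : 2 `^ (2 * n%:R * log2 n%:R) = (n ^ 2)%N%:R ^+ n :> R.
  rewrite /powR pnatr_eq0 /= /log2 -mulrA divfK ?gt_eqF//.
  rewrite natrX -exprM -natrM.
  by rewrite expRM_natl lnK ?posrE ?ltr0n.
(* For [n = 1] the first factor is 1 and cannot absorb the signs; the single interval [[-1, 1]] is
   used instead. *)
have [n_le1|n_gt1] := leqP n 1.
  have {n_le1}-> : n = 1%N by apply/eqP; rewrite eqn_leq n_le1.
  exists 1%N; last first.
    rewrite expr1n mul1r expr1 lerDl /log2 divr_ge0 ?(ltW ln2_gt0)//.
    by rewrite ln_ge0// ler_pdivlMr// mul1r ltW.
  have := @coverable_of_interval_cover R 1 eps unit (fun=> 0) (fun=> 1).
  rewrite card_unit; apply=> // [_|x xeps]; first by rewrite normr0 add0r.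
  by exists tt; rewrite subr0 divr1 ler_norml; lra.
have [K [K_gt0 qK Kn]] := geometric_index _ _ _ n_ge1 eps_gt0 eps_lt1.
exists ((2 * K) ^ n)%N; first exact: geometric_cover.
rewrite natrX -exprMn lerXn2r ?nnegrE//.
  (* The sign of [1 + log2 (1 / eps)] is read off from [Kn], as [0 <= K]. *)
  by rewrite mulr_ge0// -(pmulr_rge0 _ (_ : 0 < n%:R)) ?ltr0n// (le_trans _ Kn).
rewrite natrM; apply: (@le_trans _ _ (n%:R * K%:R)).
  by rewrite ler_wpM2r// ler_nat.
by rewrite natrX expr2 -mulrA ler_wpM2l.
Qed.
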